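(* Let $B=(V,E)$ be a generalized Bratteli diagram. For a given positive vector $q^{(0)}=(q^{(0)}_v: v\in V_0)$ and a given sequence of probability transition kernels $(P_n)_{n\ge 0}$ (determined by Markov matrices $(p^{(n)}_{v,e})$ on $B$), let $(q^{(n)})_{n\ge0}$ be the sequence of positive vectors defined inductively by $$q^{(n+1)}_u=\sum_{e\in E_n:\ r(e)=u}q^{(n)}_{s(e)}\,p^{(n)}_{s(e),e},\qquad u\in V_{n+1}.$$ Then there exists a sequence of probability transition kernels $Q_n$ (from $V_{n+1}$ to $V_n$) such that, for every $n\ge 0$ and any subsets $A\subset V_n$ and $C\subset V_{n+1}$, $$\sum_{v\in A}q^{(n)}_vP_n(v,C)=\sum_{u\in C}q^{(n+1)}_uQ_n(u,A).$$
   Context: A generalized Bratteli diagram $B=(V,E)$ is a graded graph with $V=\bigsqcup_{n\ge0}V_n$, each $V_n$ being a copy of a fixed countably infinite set $V_0$, and $E=\bigsqcup_{n\ge 0}E_n$, where $E_n$ is the set of edges between $V_n$ and $V_{n+1}$. Each $e\in E_n$ has a source $s(e)\in V_n$ and a range $r(e)\in V_{n+1}$. For $w\in V_n$, $v\in V_{n+1}$ the set $E(w,v)$ of edges with source $w$ and range $v$ is finite (possibly empty), and $f^{(n)}_{vw}=|E(w,v)|$. The incidence matrix $F_n=(f^{(n)}_{vw}: v\in V_{n+1}, w\in V_n)$ has only finitely many non-zero entries in each row (so $r^{-1}(u)$ is finite for every $u\in V_{n+1}$) and has no zero row and no zero column. A sequence of Markov matrices on $B$ is a sequence $P_n=(p^{(n)}_{v,e}: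 v\in V_n, e\in E_n)$ of non-negative matrices with $p^{(n)}_{v,e}>0\iff s(e)=v$, and $\sum_{e:\,s(e)=v}p^{(n)}_{v,e}=1$ for all $v\in V_n$. The associated probability transition kernel is $P_n(v,C)=\sum_{e\in E_n:\ s(e)=v,\ r(e)\in C}p^{(n)}_{v,e}$ for $v\in V_n$, $C\subset V_{n+1}$. A probability transition kernel $Q_n$ from $V_{n+1}$ to $V_n$ assigns to each $u\in V_{n+1}$ a probability measure $Q_n(u,\cdot)$ on $V_n$. *)

(* Defs.v *)
From HB Require Import structures.
From mathcomp Require Import all_boot all_order all_algebra finmap.
From mathcomp Require Import all_classical all_reals all_analysis.
From mathcomp Require Import measurable_realfun.

Set Implicit Arguments.
Unset Strict Implicit.
Unset Printing Implicit Defensive.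

Import Order.TTheory GRing.Theory Num.Theory.

Local Open Scope classical_set_scope.
Local Open Scope ring_scope.

(* [T] with the sigma-algebra of all its subsets. *)
Definition discrete (T : pointedType) : Type := T.

HB.instance Definition _ (T : pointedType) := Pointed.on (discrete T).
HB.instance Definition _ (T : pointedType) :=
  @isMeasurable.Build default_measure_display (discrete T)
    discrete_measurable discrete_measurable0
    discrete_measurableC discrete_measurableU.

Section incidence.
Context (V : Type) (E : choiceType) (s r : E -> V).

Definition edges_between (w v : V) : set E := [set e | s e = w /\ r e = v].

(* The cardinal is meaningful only if [edges_between w v] is finite. *)
Definition incidence (v w : V) : nat := #|` fset_set (edges_between w v)|.

End incidence.

(* Every level V_n is a copy of one and the same type [vertex], the levels
   being told apart by the index [n] only; it is pointed because the library
   requires measurable types to be. The edges in [edge n] go from level [n] to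
   level [n.+1]. *)
Record generalizedBratteliDiagram := GeneralizedBratteliDiagram {
  vertex : pointedType ;
  edge : nat -> choiceType ;
  edge_source : forall n, edge n -> vertex ;
  edge_range : forall n, edge n -> vertex ;
  vertex_countably_infinite : ([set: vertex] #= [set: nat])%card ;
  finite_edges_between : forall n w v,
    finite_set (edges_between (@edge_source n) (@edge_range n) w v) ;
  incidence_row_finite : forall n v,
    finite_set [set w | incidence (@edge_source n) (@edge_range n) v w != 0%N] ;
  incidence_row_neq0 : forall n v,
    exists w, incidence (@edge_source n) (@edge_range n) v w != 0%N ;
  incidence_col_neq0 : forall n w,
    exists v, incidence (@edge_source n) (@edge_range n) v w != 0%N }.

Record markovMatrix (R : realType) (B : generalizedBratteliDiagram) (n : nat) :=
  MarkovMatrix {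
  markov_coef :> vertex B -> edge B n -> R ;
  markov_ge0 : forall v e, 0 <= markov_coef v e ;
  markov_gt0 : forall v e, 0 < markov_coef v e <-> edge_source e = v ;
  markov_sum1 : forall v,
    (\esum_(e in [set e | edge_source e = v]) (markov_coef v e)%:E = 1)%E }.

Section transition_kernel.
Context (R : realType) (B : generalizedBratteliDiagram) (n : nat).
Variable p : markovMatrix R B n.
Local Open Scope ereal_scope.

Definition transition (v : discrete (vertex B)) (C : set (discrete (vertex B))) :
    \bar R :=
  \esum_(e in [set e | edge_source e = v /\ C (edge_range e)]) (p v e)%:E.

Let transition0 v : transition v set0 = 0.
Proof.
by rewrite /transition (_ : [set _ | _] = set0) ?esum_set0// -subset0 => e [].
Qed.

Let transition_ge0 v C : 0 <= transition v C.
Proof. by apply: esum_ge0 => e _; rewrite lee_fin markov_ge0. Qed.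

Let transition_sigma_additive v : semi_sigma_additive (transition v).
Proof.
move=> F _ tF _.
have -> : transition v (\bigcup_i F i) = \sum_(i <oo) transition v (F i).
  rewrite nneseries_esumT// {1}/transition.
  rewrite (_ : [set _ | _] =
      \bigcup_i [set e | edge_source e = v /\ F i (edge_range e)]); last first.
    apply/seteqP; split => [e [ve [i _ Fi]]|e [i _ [ve Fi]]]; first by exists i.
    by split => //; exists i.
  rewrite esum_bigcupT//.
    apply/trivIsetP => i j _ _ ij; rewrite -subset0 => e [[_ Fi] [_ Fj]].
    by move/trivIsetP : tF => /(_ i j I I ij); rewrite -subset0; apply; split; eauto.
  by move=> e; rewrite lee_fin markov_ge0.
exact: is_cvg_ereal_nneg_natsum.
Qed.

HB.instance Definition _ v := isMeasure.Build _ _ _ (transition v)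
  (transition0 v) (transition_ge0 v) (@transition_sigma_additive v).

Definition transition_measure v :
    {measure set (discrete (vertex B)) -> \bar R} := transition v.

Let transition_measurable U : measurable U ->
  measurable_fun [set: discrete (vertex B)] (transition_measure ^~ U).
Proof. by []. Qed.

HB.instance Definition _ := isKernel.Build _ _ _ _ _ transition_measure
  transition_measurable.

Let transition_setT v : transition_measure v setT = 1.
Proof.
rewrite -(markov_sum1 p v) /transition_measure/= /transition.
by congr esum; apply/seteqP; split => e //= [].
Qed.

HB.instance Definition _ := Kernel_isProbability.Build _ _ _ _ _
  transition_measure transition_setT.

Definition transition_kernel :
    R.-pker (discrete (vertex B)) ~> (discrete (vertex B)) := transition_measure.

End transition_kernel.

Section level_vector.
Context (R : realType) (B : generalizedBratteliDiagram).
Variables (q0 : vertex B -> R) (p : forall n, markovMatrix R B n).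

(* [\sum_(e \in _)] is meaningful because finitely many edges have range [u],
   cf. [finite_range_fiber] below. *)
Fixpoint level_vector n : vertex B -> R :=
  if n is m.+1 then
    fun u => \sum_(e \in [set e : edge B m | edge_range e = u])
      level_vector m (edge_source e) * p m (edge_source e) e
  else q0.

End level_vector.

Lemma incidence_neq0 (B : generalizedBratteliDiagram) n (v w : vertex B) :
  incidence (@edge_source B n) (@edge_range B n) v w != 0%N <->
  exists e, edges_between (@edge_source B n) (@edge_range B n) w v e.
Proof.
have fE := @finite_edges_between B n w v.
rewrite /incidence cardfs_eq0; split.
  by move=> /fset0Pn[e]; rewrite in_fset_set// inE => ?; exists e.
by move=> [e ee]; apply/fset0Pn; exists e; rewrite in_fset_set// inE.
Qed.

Lemma finite_range_fiber (B : generalizedBratteliDiagram) n (u : vertex B) :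
  finite_set [set e : edge B n | edge_range e = u].
Proof.
rewrite (_ : [set _ | _] = \bigcup_(w in
    [set w | incidence (@edge_source B n) (@edge_range B n) u w != 0%N])
    edges_between (@edge_source B n) (@edge_range B n) w u).
  apply: bigcup_finite; first exact: incidence_row_finite.
  by move=> w _; exact: finite_edges_between.
apply/seteqP; split => [e eu|e [w _ []]//].
exists (edge_source e) => //=.
by apply/incidence_neq0; exists e.
Qed.

Lemma level_vector_gt0 (R : realType) (B : generalizedBratteliDiagram)
    (q0 : vertex B -> R) (p : forall n, markovMatrix R B n) :
  (forall v, 0 < q0 v) -> forall n v, 0 < level_vector q0 p n v.
Proof.
move=> q00; elim => [//|n IH] u /=.
have pos e : 0 < level_vector q0 p n (edge_source e) * p n (edge_source e) e.
  by rewrite mulr_gt0// markov_gt0.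
have [w /incidence_neq0[e0 [_ e0u]]] := @incidence_row_neq0 B n u.
rewrite (fsbigD1 e0)//=; last first.
  by apply: sub_finite_set (finite_range_fiber n u) => e [].
by rewrite ltr_wpDr// fsumr_ge0// => e _; exact/ltW.
Qed.

(* Main.v *)
From HB Require Import structures.
Require Import Defs.
From mathcomp Require Import all_boot all_order all_algebra.
From mathcomp Require Import all_classical all_reals all_analysis.
From mathcomp Require Import measurable_realfun.

(** [Q_n] is the time reversal of [P_n]: it goes backwards along an edge [e] with
    probability [q^(n)_{s(e)} p_{s(e),e} / q^(n+1)_{r(e)}], which sums to [1] over
    [r^-1(u)] by definition of [q^(n+1)_u]. Both sides of the identity are then
    the total mass [q^(n)_{s(e)} p_{s(e),e}] of the edges with source in [A] and
    range in [C], summed by source on the left and by range on the right. *)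

Import Order.TTheory GRing.Theory Num.Theory.

Local Open Scope classical_set_scope.
Local Open Scope ring_scope.
Local Open Scope ereal_scope.

(** Comparing finite partial sums gives one inequality for every positive factor; the reverse one is
    the same bound for the factor [c^-1] and the family [c%:E * a i]. *)
Lemma esumZl (R : realType) (T : choiceType) (D : set T) (c : R)
    (a : T -> \bar R) : (0 < c)%R -> (forall i, 0 <= a i) ->
  \esum_(i in D) (c%:E * a i) = c%:E * \esum_(i in D) a i.
Proof.
have le_esumZl (k : R) (b : T -> \bar R) : (0 < k)%R -> (forall i, 0 <= b i) ->
    \esum_(i in D) (k%:E * b i) <= k%:E * \esum_(i in D) b i.
  move=> k0 b0; apply: ge_ereal_sup => _ [X [finX XD] <-].
  rewrite -ge0_mule_fsumr// lee_pmul2l// -?EFinM ?lte_fin//.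
  by apply: esum_ge; exists X.
move=> c0 a0; apply/eqP; rewrite eq_le le_esumZl//=.
have cV0 : (0 < c^-1)%R by rewrite invr_gt0.
have ca0 i : 0 <= c%:E * a i by rewrite mule_ge0// lee_fin ltW.
have := le_esumZl _ _ cV0 ca0; rewrite lee_pdivlMl//.
by under eq_esum do rewrite muleA -EFinM mulVf ?gt_eqF// mul1e.
Qed.

(** The double sum runs over pairs [(v, e)] with [f e = v], and [e] alone determines such a pair.
    This is what allows edges to be grouped by source or by range. *)
Lemma esum_fiber (R : realType) (E T : choiceType) (f : E -> T) (A : set T)
    (D : set E) (a : E -> \bar R) : (forall e, 0 <= a e) ->
  \esum_(v in A) \esum_(e in [set e | f e = v /\ D e]) a e =
  \esum_(e in [set e | A (f e) /\ D e]) a e.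
Proof.
move=> a0; rewrite esum_esum//.
apply: (reindex_esum _ _ (fun e => (f e, e))); split.
- by move=> e [/= Ae De].
- by move=> e e' _ _ [].
- by move=> [v e] [/= Av [fe De]]; exists e; rewrite ?fe.
Qed.

Section edge_kernel.
Context {R : realType} {E : choiceType} {T : pointedType} (f g : E -> T).
Context {a : E -> R} (a_ge0 : forall e, (0 <= a e)%R).
Context (a_sum1 : forall v, \esum_(e in [set e | f e = v]) (a e)%:E = 1).

(** The law of [g e] when [e] is drawn from the fibre of [f] over [v] with weights [a]. Keeping [f]
    and [g] abstract lets edges be traversed against their direction. *)
Definition edge_mass (v : discrete T) (A : set (discrete T)) : \bar R :=
  \esum_(e in [set e | f e = v /\ A (g e)]) (a e)%:E.

Let edge_mass0 v : edge_mass v set0 = 0.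
Proof. by apply: esum1 => e []. Qed.

Let edge_mass_ge0 v A : 0 <= edge_mass v A.
Proof. by apply: esum_ge0 => e _; rewrite lee_fin. Qed.

Let edge_mass_sigma_additive v : semi_sigma_additive (edge_mass v).
Proof.
move=> F _ tF _.
have -> : edge_mass v (\bigcup_i F i) = \sum_(i <oo) edge_mass v (F i).
  rewrite -nneseries_sum_bigcup//; last first.
    by move=> i j _ _ [e [[_ Fi] [_ Fj]]]; apply: tF => //; exists (g e).
  congr esum; apply/seteqP; split => [e [ve [i _ Fi]]|e [i _ [ve Fi]]].
    by exists i.
  by split => //; exists i.
exact: is_cvg_ereal_nneg_natsum.
Qed.

HB.instance Definition _ v := isMeasure.Build _ _ _ (edge_mass v)
  (edge_mass0 v) (edge_mass_ge0 v) (@edge_mass_sigma_additive v).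

Definition edge_measure v : {measure set (discrete T) -> \bar R} := edge_mass v.

Let edge_measurable U : measurable U ->
  measurable_fun [set: discrete T] (edge_measure ^~ U).
Proof. by []. Qed.

HB.instance Definition _ := isKernel.Build _ _ _ _ _ edge_measure
  edge_measurable.

Let edge_measure_setT v : edge_measure v setT = 1.
Proof.
rewrite -(a_sum1 v); congr esum.
by apply/seteqP; split => e //= [].
Qed.

HB.instance Definition _ := Kernel_isProbability.Build _ _ _ _ _
  edge_measure edge_measure_setT.

Definition edge_kernel : R.-pker (discrete T) ~> (discrete T) := edge_measure.

End edge_kernel.

Section reverse_weight.
Context {R : realType} {B : generalizedBratteliDiagram}.
Context (q0 : vertex B -> R) (p : forall n, markovMatrix R B n).
Context (q0_gt0 : forall v, (0 < q0 v)%R).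

Definition edge_flow n (e : edge B n) : R :=
  (level_vector q0 p n (edge_source e) * p n (edge_source e) e)%R.

Definition reverse_weight n (e : edge B n) : R :=
  (edge_flow n e / level_vector q0 p n.+1 (edge_range e))%R.

Lemma edge_flow_ge0 n (e : edge B n) : (0 <= edge_flow n e)%R.
Proof. by rewrite mulr_ge0 ?markov_ge0// ltW// level_vector_gt0. Qed.

Lemma reverse_weight_ge0 n (e : edge B n) : (0 <= reverse_weight n e)%R.
Proof. by rewrite divr_ge0 ?edge_flow_ge0// ltW// level_vector_gt0. Qed.

Lemma level_vector_reverse_weight n (e : edge B n) :
  (level_vector q0 p n.+1 (edge_range e) * reverse_weight n e)%R = edge_flow n e.
Proof. by rewrite mulrC divfK// gt_eqF// level_vector_gt0. Qed.

(** The identity is first proved after multiplication by the positive real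
    [level_vector q0 p n.+1 u], which is then cancelled. *)
Lemma reverse_weight_sum1 n (u : vertex B) :
  \esum_(e in [set e : edge B n | edge_range e = u]) (reverse_weight n e)%:E = 1.
Proof.
have q_gt0 := level_vector_gt0 p q0_gt0 n.+1 u.
have : (level_vector q0 p n.+1 u)%:E *
    (\esum_(e in [set e : edge B n | edge_range e = u]) (reverse_weight n e)%:E)
    = (level_vector q0 p n.+1 u)%:E.
  rewrite -esumZl//; last by move=> e; rewrite lee_fin reverse_weight_ge0.
  transitivity
    (\esum_(e in [set e : edge B n | edge_range e = u]) (edge_flow n e)%:E).
    apply: eq_esum => e <-.
    by rewrite -EFinM level_vector_reverse_weight.
  (* Since the fibre is finite, this is the finite sum that defines [level_vector] at level
     [n.+1]. *)
  rewrite esum_fset; [|exact: finite_range_fiber|].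
    by rewrite fsumEFin//; exact: finite_range_fiber.
  by move=> e _; rewrite lee_fin edge_flow_ge0.
move/(congr1 (fun x => (level_vector q0 p n.+1 u)^-1%:E * x)).
by rewrite muleA -!EFinM !mulVf ?gt_eqF// mul1e.
Qed.

End reverse_weight.

Theorem theorem3p5 (R : realType) (B : generalizedBratteliDiagram)
    (q0 : vertex B -> R) (p : forall n : nat, markovMatrix R B n)
    (q0_gt0 : forall v : vertex B, (0 < q0 v)%R) :
  exists Q : forall n : nat,
      R.-pker (discrete (vertex B)) ~> (discrete (vertex B)),
    forall (n : nat) (A C : set (discrete (vertex B))),
      \esum_(v in A) ((level_vector q0 p n v)%:E * transition_kernel (p n) v C) =
      \esum_(u in C) ((level_vector q0 p n.+1 u)%:E * Q n u A).
Proof.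
(* All levels share one vertex type, so only the order range, then source makes this kernel go from
   level [n.+1] back to level [n]. *)
exists (fun n => edge_kernel (@edge_range B n) (@edge_source B n)
  (reverse_weight_ge0 q0 p q0_gt0 n) (reverse_weight_sum1 q0 p q0_gt0 n)).
move=> n A C.
have flow_ge0 (e : edge B n) : 0 <= (edge_flow q0 p n e)%:E.
  by rewrite lee_fin edge_flow_ge0.
(* On edges with source [v], the factor [level_vector q0 p n v] turns the Markov coefficient into
   the flow. *)
transitivity (\esum_(v in A) \esum_(e in [set e : edge B n |
    edge_source e = v /\ C (edge_range e)]) (edge_flow q0 p n e)%:E).
  apply: eq_esum => v _; rewrite -esumZl ?level_vector_gt0//; last first.
    by move=> e; rewrite lee_fin markov_ge0.
  by apply: eq_esum => e [<- _]; rewrite -EFinM.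
transitivity (\esum_(u in C) \esum_(e in [set e : edge B n |
    edge_range e = u /\ A (edge_source e)]) (edge_flow q0 p n e)%:E).
  (* Both groupings reduce to one sum over the edges from [A] to [C]. *)
  rewrite !esum_fiber//; congr esum.
  by apply/seteqP; split => e [].
(* The factor at [u] cancels the denominator of [reverse_weight]. *)
apply: eq_esum => u _; rewrite -esumZl ?level_vector_gt0//; last first.
  by move=> e; rewrite lee_fin reverse_weight_ge0.
by apply: eq_esum => e [<- _]; rewrite -EFinM level_vector_reverse_weight.
Qed.
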